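(* Let $\mathbb{K}$ be a field of characteristic zero. Let $P(t),Q(t)\in\mathbb{K}[t]$ be nonzero polynomials that are not proportional to each other, let $n=\max\{\deg P,\deg Q\}$, and let $\Phi=\{\phi_0(t),\dots,\phi_{n-1}(t)\}$ be a basis of the space of polynomials of degree at most $n-1$. Then the null space of the Bezout matrix $\mathrm{Bez}_\Phi(P,Q)$ is spanned by the columns of the matrix $$\left(X_1^\Phi, X_2^\Phi,\ldots,X_k^\Phi\right),$$ where each block $X_j^\Phi$ corresponds to a different common root $x_j$ of $P(t)$ and $Q(t)$. The dimension (number of columns) of each block $X_j^\Phi$ is the geometric multiplicity $k_j$ of the common root $x_j$, i.e., its multiplicity as a root of the greatest common divisor of $P(t)$ and $Q(t)$. Moreover, each block can be parameterized by the common root $x_j$ in the form $$X_j^\Phi=\begin{pmatrix} \phi_0(x_j) & \phi_0^{(1)}(x_j) & \cdots & \phi_0^{(k_j-1)}(x_j)\\ \phi_1(x_j) & \phi_1^{(1)}(x_j) & \cdots & \phi_1^{(k_j-1)}(x_j)\\ \vdots & \vdots & & \vdots\\ \phi_{n-1}(x_j) & \phi_{n-1}^{(1)}(x_j) & \cdots & \phi_{n-1}^{(k_j-1)}(x_j) \end{pmatrix},$$ where $\phi^{(i)}$ denotes the $i$-th derivative of $\phi$.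
   Context: Bezout matrix: for polynomials $P,Q\in\mathbb{K}[t]$ with $n=\max\{\deg P,\deg Q\}$, the Cayley quotient is the bivariate polynomial $$C_{P,Q}(t,x)=\frac{P(t)Q(x)-P(x)Q(t)}{t-x},$$ which has degree at most $n-1$ in each variable. Given a basis $\Phi=\{\phi_0,\dots,\phi_{n-1}\}$ of the space of polynomials of degree at most $n-1$, write uniquely $C_{P,Q}(t,x)=\sum_{i,j=0}^{n-1} b_{ij}\,\phi_i(t)\phi_j(x)$. The symmetric $n\times n$ matrix $\mathrm{Bez}_\Phi(P,Q)=(b_{ij})$ is the Bezout matrix of $P,Q$ in the basis $\Phi$.
   Formalization: The common roots and the null space are taken over any extension field of K in which the gcd of P and Q splits (K itself if it splits there); over K alone the claim fails, e.g. for P = t^2+1, Q = t(t^2+1) over the reals. *)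

(* Defs.v *)
From HB Require Import structures.
From mathcomp Require Import all_boot all_order all_algebra.

Set Implicit Arguments.
Unset Strict Implicit.
Unset Printing Implicit Defensive.

Import GRing.Theory.
Local Open Scope ring_scope.

(* Bivariate polynomials in (t, x) are elements of {poly {poly K}}: t is the
   outer variable 'X and x is the inner one 'X%:P; thus p(t) is p^:P and p(x)
   is p%:P.  The divisor t - x is monic and the division is exact, see
   cayley_quotientK. *)
Definition cayley_quotient (K : fieldType) (P Q : {poly K}) :
    {poly {poly K}} :=
  (map_poly polyC P * Q%:P - P%:P * map_poly polyC Q) %/ ('X - ('X)%:P).

(* B = Bez_Phi(P, Q); by bezout_mx_exists_unique there is exactly one such B
   when deg P, deg Q <= n and Phi is a basis. *)
Definition is_bezout_mx (K : fieldType) (n : nat) (Phi : n.-tuple {poly_n K})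
    (P Q : {poly K}) (B : 'M[K]_n) : Prop :=
  cayley_quotient P Q =
    \sum_(i < n) \sum_(j < n) (B i j)%:P%:P
      * map_poly polyC (tnth Phi i : {poly K}) * (tnth Phi j : {poly K})%:P.

(* The field L, seen as an extension of K through iota, contains all the roots
   of p.  Any algebraically closed L qualifies, see closed_splits_over. *)
Definition splits_over (K L : fieldType) (iota : {rmorphism K -> L})
    (p : {poly K}) : Prop :=
  exists s : seq L, map_poly iota p %= \prod_(z <- s) ('X - z%:P).

Definition root_block (K L : fieldType) (iota : {rmorphism K -> L}) (n : nat)
    (Phi : n.-tuple {poly_n K}) (z : L) (m : nat) : 'M[L]_(n, m) :=
  \matrix_(i < n, l < m)
    ((map_poly iota (tnth Phi i : {poly K}))^`(l)).[z].

Lemma closed_splits_over (K : fieldType) (L : closedFieldType)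
    (iota : {rmorphism K -> L}) (p : {poly K}) : p != 0 -> splits_over iota p.
Proof.
move=> p0; have [s Es] := closed_field_poly_normal (map_poly iota p).
exists s; rewrite [X in X %= _]Es; apply: eqp_scale.
by rewrite lead_coef_eq0 map_poly_eq0.
Qed.

Lemma cayley_quotientK (K : fieldType) (P Q : {poly K}) :
  cayley_quotient P Q * ('X - ('X)%:P) =
    map_poly polyC P * Q%:P - P%:P * map_poly polyC Q.
Proof.
apply: Pdiv.IdomainUnit.divpK; first by rewrite lead_coefXsubC unitr1.
rewrite dvdp_XsubCl /root !hornerE.
have E (p : {poly K}) : (map_poly polyC p).['X] = p.
  exact: comp_polyXr.
by rewrite !E subrr.
Qed.

Lemma size_cayley_quotient (K : fieldType) (n : nat) (P Q : {poly K}) :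
  (size P <= n.+1)%N -> (size Q <= n.+1)%N ->
  (size (cayley_quotient P Q) <= n)%N.
Proof.
move=> sP sQ; case: (eqVneq (cayley_quotient P Q) 0) => [->|C0].
  by rewrite size_poly0.
have := congr1 (fun u : {poly {poly K}} => size u) (cayley_quotientK P Q).
rewrite /= size_Mmonic ?monicXsubC // size_XsubC addn2 /= => eqs.
rewrite -ltnS eqs; apply: leq_trans (size_polyD _ _) _.
rewrite size_polyN geq_max mulrC !mul_polyC.
by rewrite !(leq_trans (size_scale_leq _ _)) // (leq_trans (size_poly _ _)).
Qed.

Lemma swapXY_cayley_quotient (K : fieldType) (P Q : {poly K}) :
  swapXY (cayley_quotient P Q) = cayley_quotient P Q.
Proof.
have nz : ('X - ('X)%:P : {poly {poly K}}) != 0 by rewrite polyXsubC_eq0.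
apply: (mulIf nz); rewrite cayley_quotientK.
have := congr1 swapXY (cayley_quotientK P Q).
rewrite rmorphM /= !rmorphB !rmorphM /= swapXY_X swapXY_Y.
rewrite !swapXY_polyC !swapXY_map_polyC => H.
by rewrite -opprB mulrN H opprB mulrC [X in _ - X]mulrC.
Qed.

Lemma cayley_quotient_coefE (K : fieldType) (n : nat) (P Q : {poly K}) :
  (size P <= n.+1)%N -> (size Q <= n.+1)%N ->
  cayley_quotient P Q = \sum_(k < n) \sum_(l < n)
    ((cayley_quotient P Q)`_k`_l)%:P%:P * map_poly polyC 'X^k * ('X^l)%:P.
Proof.
move=> sP sQ; have sC := size_cayley_quotient sP sQ.
have coef0C i j : (n <= i)%N -> (cayley_quotient P Q)`_i`_j = 0.
  by move=> ni; rewrite (nth_default 0 (leq_trans sC ni)) coef0.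
have sCi i : (size ((cayley_quotient P Q)`_i)%R <= n)%N.
  apply/leq_sizeP => j nj.
  by rewrite -swapXY_cayley_quotient coef_swapXY coef0C.
have CE : cayley_quotient P Q = \sum_(k < n) (cayley_quotient P Q)`_k *: 'X^k.
  rewrite -poly_def; apply/polyP => k; rewrite coef_poly.
  by case: ltnP => // nk; rewrite nth_default // (leq_trans sC).
rewrite [LHS]CE; apply: eq_bigr => k _.
have {1}-> : (cayley_quotient P Q)`_k =
    \sum_(l < n) (cayley_quotient P Q)`_k`_l *: 'X^l.
  rewrite -poly_def; apply/polyP => l; rewrite coef_poly.
  by case: ltnP => // nl; rewrite nth_default // (leq_trans (sCi k)).
rewrite scaler_suml map_polyXn; apply: eq_bigr => l _.
by rewrite -!mul_polyC rmorphM /= mulrAC.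
Qed.

Lemma bezout_mx_unique (K : fieldType) (n : nat)
    (Phi : n.-tuple {poly_n K}) (P Q : {poly K}) (B B' : 'M[K]_n) :
  basis_of fullv Phi -> is_bezout_mx Phi P Q B -> is_bezout_mx Phi P Q B' ->
  B = B'.
Proof.
move=> bPhi; rewrite /is_bezout_mx => HB HB'.
have freePhi (c : 'I_n -> K) :
    \sum_(i < n) c i *: (tnth Phi i : {poly K}) = 0 -> forall i, c i = 0.
  move=> c0; have /freeP := basis_free bPhi; apply; apply: val_inj.
  rewrite /= raddf_sum /= -[RHS]c0; apply: eq_bigr => i _.
  by rewrite (tnth_nth 0).
have coefE (D : 'M[K]_n) (k : nat) : (\sum_(i < n) \sum_(j < n) (D i j)%:P%:P
      * map_poly polyC (tnth Phi i : {poly K}) * (tnth Phi j : {poly K})%:P)`_k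
    = \sum_(j < n) (\sum_(i < n) D i j * (tnth Phi i : {poly K})`_k)
        *: (tnth Phi j : {poly K}).
  rewrite exchange_big coef_sum; apply: eq_bigr => j _.
  rewrite coef_sum scaler_suml; apply: eq_bigr => i _.
  by rewrite coefMC coefCM coef_map /= -mul_polyC rmorphM.
apply/matrixP => i j; apply/eqP; rewrite -subr_eq0; apply/eqP; move: i.
apply: (freePhi _ _); apply/polyP => k.
rewrite coef0 coef_sum; move: j.
apply: (freePhi _ _); have := congr1 (fun u : {poly {poly K}} => u`_k) HB'.
rewrite [in LHS]HB !coefE => /eqP; rewrite -subr_eq0 -sumrB => /eqP E.
rewrite -[RHS]E; apply: eq_bigr => j _; rewrite -scalerBl -sumrB; congr (_ *: _).
by apply: eq_bigr => i _; rewrite coefZ mulrBl.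
Qed.

Lemma bezout_mx_exists_unique (K : fieldType) (n : nat)
    (Phi : n.-tuple {poly_n K}) (P Q : {poly K}) :
  (size P <= n.+1)%N -> (size Q <= n.+1)%N -> basis_of fullv Phi ->
  exists! B : 'M[K]_n, is_bezout_mx Phi P Q B.
Proof.
move=> sP sQ bPhi.
have [a XE] : exists a : 'I_n -> 'I_n -> K, forall k : 'I_n,
    'X^k = \sum_(i < n) a i k *: (tnth Phi i : {poly K}).
  exists (fun i k => coord Phi i (npolyX K n)`_k) => k.
  rewrite -npolyXE -nth_npolyX.
  rewrite [X in polyn X = _](coord_basis bPhi (memvf _)) raddf_sum /=.
  by apply: eq_bigr => i _; rewrite (tnth_nth 0).
pose B := \matrix_(i, j) \sum_(k < n) \sum_(l < n)
   (cayley_quotient P Q)`_k`_l * a i k * a j l.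
suff HB : is_bezout_mx Phi P Q B.
  by exists B; split=> // B'; apply: bezout_mx_unique.
rewrite /is_bezout_mx [LHS](cayley_quotient_coefE sP sQ).
have -> : \sum_(k < n) \sum_(l < n)
    ((cayley_quotient P Q)`_k`_l)%:P%:P * map_poly polyC 'X^k * ('X^l)%:P =
  \sum_(k < n) \sum_(l < n) \sum_(i < n) \sum_(j < n)
    ((cayley_quotient P Q)`_k`_l * a i k * a j l)%:P%:P
    * map_poly polyC (tnth Phi i : {poly K}) * (tnth Phi j : {poly K})%:P.
  apply: eq_bigr => k _; apply: eq_bigr => l _.
  rewrite (XE k) (XE l) !rmorph_sum /= -mulrA mulr_suml mulr_sumr.
  apply: eq_bigr => i _; rewrite !mulr_sumr; apply: eq_bigr => j _.
  rewrite -!mul_polyC !rmorphM /= map_polyC /= -!mulrA.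
  by congr (_ * (_ * _)); rewrite mulrCA.
under eq_bigr do rewrite exchange_big /=.
rewrite exchange_big /=; apply: eq_bigr => i _.
under eq_bigr do rewrite exchange_big /=.
rewrite exchange_big /=; apply: eq_bigr => j _.
rewrite mxE !rmorph_sum !mulr_suml; apply: eq_bigr => k _.
by rewrite !rmorph_sum !mulr_suml.
Qed.

(* Main.v *)
Require Import Defs.
From HB Require Import structures.
From mathcomp Require Import all_boot all_order all_algebra.
From mathcomp Require Import ring.

Set Implicit Arguments.
Unset Strict Implicit.
Unset Printing Implicit Defensive.

Import GRing.Theory.
Local Open Scope ring_scope.

(** Write [C = \sum_k c_k(x) t^k] for the Cayley quotient of [P] and [Q], and
    [p_k], [q_k] for the coefficients of [P] and [Q].  Comparing the
    coefficients of [t^k] in [(t - x) C = P(t) Q(x) - P(x) Q(t)] gives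

      [c_(k-1) = x c_k + p_k Q - q_k P]          ([cayley_quotient_coef])

    and everything about the Bezout matrix follows from this recursion.

    The span of the [c_k] is the set of the multiples of [gcd(P, Q)] of degree
    less than [n] ([row_space_cayley_mx]).  The recursion, started at
    [c_n = 0] and run downwards, shows that a common divisor of [P] and [Q]
    divides every [c_k].  Conversely, say that [P] has degree [n] (exchanging
    [P] and [Q] only changes the sign of [C]).  Modulo [P], the recursion says
    that the span of the [c_k] is stable under multiplication by [x], and that
    it contains [Q], because [c_(n-1) = p_n Q - q_n P].  So modulo [P] the span
    contains the ideal of [Q], hence all the multiples of the gcd, and
    congruence modulo [P] is equality between polynomials of degree less
    than [n].

    In characteristic zero, over a field where the gcd splits, a polynomial
    [f = \sum_i u_i phi_i] is a multiple of the gcd if and only if its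
    derivatives of order less than [k_j] vanish at each common root [x_j]
    ([dvdp_split_mup], [dvdp_XsubCX_derivn]).  The latter says that the row
    vector [u] is orthogonal to all the columns of [(X_1, ..., X_k)].

    Up to the change of basis from [Phi] to the monomials, the rows of the
    Bezout matrix are the [c_k].  Its row space is therefore the left kernel of
    [(X_1, ..., X_k)], and by duality its null space is the column space of
    [(X_1, ..., X_k)] ([null_space_eq_col_space]). *)

(** * The Cayley quotient and the ideal of the gcd *)

(** This is the coefficient of [t^k] in
    [(t - x) C(t, x) = P(t) Q(x) - P(x) Q(t)]; the product with ['X] on the left
    is the shifted coefficient [c_(k-1)], read as [0] when [k = 0]. *)
Lemma cayley_quotient_coef (F : fieldType) (P Q : {poly F}) k :
  (cayley_quotient P Q * 'X)`_k
  = 'X * (cayley_quotient P Q)`_k + P`_k *: Q - Q`_k *: P.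
Proof.
have := congr1 (fun u : {poly {poly F}} => u`_k) (cayley_quotientK P Q).
rewrite /= mulrBr !coefB !coefMC coefCM !coef_map /= -!mul_polyC.
by move=> /(canRL (subrK _)) ->; ring.
Qed.

Lemma cayley_quotientC (F : fieldType) (P Q : {poly F}) :
  cayley_quotient Q P = - cayley_quotient P Q.
Proof.
have nz : ('X - ('X)%:P : {poly {poly F}}) != 0 by rewrite polyXsubC_eq0.
by apply: (mulIf nz); rewrite mulNr !cayley_quotientK; ring.
Qed.

Lemma map_cayley_quotient (K L : fieldType) (iota : {rmorphism K -> L})
    (P Q : {poly K}) :
  map_poly (map_poly iota) (cayley_quotient P Q) =
  cayley_quotient (map_poly iota P) (map_poly iota Q).
Proof.
have nz : ('X - ('X)%:P : {poly {poly L}}) != 0 by rewrite polyXsubC_eq0.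
apply: (mulIf nz); rewrite cayley_quotientK.
have := congr1 (map_poly (map_poly iota)) (cayley_quotientK P Q).
have mapCC (p : {poly K}) : map_poly (map_poly iota) (map_poly polyC p) =
    map_poly polyC (map_poly iota p).
  by rewrite -!map_poly_comp; apply: eq_map_poly => a /=; rewrite map_polyC.
rewrite rmorphM /= !rmorphB !rmorphM /= map_polyX !map_polyC /= map_polyX.
by rewrite !mapCC.
Qed.

(** Since [c_k] vanishes for large [k], the recursion propagates divisibility
    from high to low indices. *)
Lemma dvdp_cayley_quotient_coef (F : fieldType) (P Q d : {poly F}) k :
  d %| P -> d %| Q -> d %| (cayley_quotient P Q)`_k.
Proof.
move=> dP dQ.
have [i] : exists i, (size (cayley_quotient P Q) <= k + i)%N.
  by exists (size (cayley_quotient P Q)); rewrite leq_addl.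
elim: i k => [|i IHi] k; first by rewrite addn0 => /(nth_default 0)->.
rewrite addnS -addSn => /IHi dC.
have := cayley_quotient_coef P Q k.+1; rewrite coefMX /= => ->.
apply: dvdp_sub; first apply: dvdp_add.
- by rewrite dvdp_mull.
- by rewrite -mul_polyC dvdp_mull.
- by rewrite -mul_polyC dvdp_mull.
Qed.

Lemma size_cayley_quotient_coef (F : fieldType) n (P Q : {poly F}) k :
  (size P <= n.+1)%N -> (size Q <= n.+1)%N ->
  (size ((cayley_quotient P Q)`_k)%R <= n)%N.
Proof.
move=> sP sQ; apply/leq_sizeP => j nj.
rewrite -swapXY_cayley_quotient coef_swapXY.
by rewrite (nth_default 0 (leq_trans (size_cayley_quotient sP sQ) nj)) coef0.
Qed.

(** * The row space of the Bezout matrix in the monomial basis *)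

(** This is the Bezout matrix in the basis of monomials. *)
Definition cayley_mx (F : fieldType) n (P Q : {poly F}) : 'M[F]_n :=
  \matrix_(k < n) poly_rV (cayley_quotient P Q)`_k.

Lemma map_cayley_mx (K L : fieldType) (iota : {rmorphism K -> L}) n
    (P Q : {poly K}) :
  map_mx iota (cayley_mx n P Q) =
  cayley_mx n (map_poly iota P) (map_poly iota Q).
Proof.
by apply/matrixP => i j; rewrite !mxE -map_cayley_quotient !coef_map.
Qed.

Lemma rVpoly_cayley_mx (F : fieldType) n (P Q : {poly F}) (w : 'rV[F]_n) :
  (size P <= n.+1)%N -> (size Q <= n.+1)%N ->
  rVpoly (w *m cayley_mx n P Q) =
  \sum_(k < n) w 0 k *: (cayley_quotient P Q)`_k.
Proof.
move=> sP sQ; rewrite mulmx_sum_row linear_sum; apply: eq_bigr => k _.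
by rewrite linearZ rowK /= poly_rV_K // size_cayley_quotient_coef.
Qed.

(** The set [V] of the polynomials that are congruent modulo [P] to a
    combination of the [c_k] is an ideal containing [Q]: the recursion gives
    both the stability under multiplication by ['X] and, at index [n], the
    membership of [Q].  The latter divides by [P`_n], whence the hypothesis that
    [P] has degree exactly [n]. *)
Lemma mul_mod_row_space_cayley_mx (F : fieldType) n (P Q h : {poly F}) :
  size P = n.+1 -> (size Q <= n.+1)%N ->
  exists w e, h * Q = rVpoly (w *m cayley_mx n P Q) + e * P.
Proof.
move=> sP sQ; have sP' : (size P <= n.+1)%N by rewrite sP.
pose V f := exists w e, f = rVpoly (w *m cayley_mx n P Q) + e * P.
have VD f1 f2 : V f1 -> V f2 -> V (f1 + f2).
  move=> [w1 [e1 ->]] [w2 [e2 ->]]; exists (w1 + w2), (e1 + e2).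
  by rewrite mulmxDl linearD /=; ring.
have VZ a f : V f -> V (a *: f).
  move=> [w [e ->]]; exists (a *: w), (a *: e).
  by rewrite -scalemxAl linearZ /= scalerDr scalerAl.
have VP f : V (f * P) by exists 0, f; rewrite mul0mx linear0 add0r.
have V0 : V 0 by rewrite -(mul0r P).
have Vc k : V (cayley_quotient P Q)`_k.
  have [ltkn | lenk] := ltnP k n; last first.
    by rewrite nth_default ?(leq_trans (size_cayley_quotient sP' sQ)).
  exists (delta_mx 0 (Ordinal ltkn)), 0.
  rewrite rVpoly_cayley_mx // mul0r addr0 (bigD1 (Ordinal ltkn)) //=.
  rewrite mxE !eqxx scale1r big1 ?addr0 // => i /negPf ni.
  by rewrite mxE ni andbF scale0r.
have VcX k : V (cayley_quotient P Q * 'X)`_k.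
  by rewrite coefMX; case: ifP.
have VQ : V Q.
  have Pn : P`_n != 0.
    by rewrite -[n]/(n.+1.-1) -sP -lead_coefE lead_coef_eq0 -size_poly_eq0 sP.
  rewrite -[Q](scalerK Pn); apply: (VZ).
  have := cayley_quotient_coef P Q n.
  rewrite (nth_default 0 (size_cayley_quotient sP' sQ)) mulr0 add0r.
  move=> /esym/(canRL (subrK _)) ->; apply: (VD) => //.
  by rewrite -mul_polyC.
have VX f : V f -> V ('X * f).
  move=> [w [e ->]]; rewrite mulrDr mulrA; apply: (VD) => //.
  rewrite rVpoly_cayley_mx // mulr_sumr.
  elim/big_ind: _ => [|f1 f2|k _] //; first exact: VD.
  rewrite -scalerAr; apply: (VZ).
  have := cayley_quotient_coef P Q k.
  move=> /esym/(canRL (subrK _))/(canRL (addrK _)) ->.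
  rewrite -scaleNr -mul_polyC; apply: (VD); last exact: VZ.
  exact: VD.
rewrite -/(V _); elim/poly_ind: h => [|h c IHh]; first by rewrite mul0r.
rewrite mulrDl mul_polyC mulrAC mulrC.
by apply: (VD); [apply: (VX) | apply: (VZ)].
Qed.

Lemma row_space_cayley_mx_lead (F : fieldType) n (P Q : {poly F})
    (u : 'rV[F]_n) :
  size P = n.+1 -> (size Q <= n.+1)%N ->
  (u <= cayley_mx n P Q)%MS = (gcdp P Q %| rVpoly u).
Proof.
move=> sP sQ; have sP' : (size P <= n.+1)%N by rewrite sP.
apply/idP/idP => [/submxP[w ->] | ].
  rewrite rVpoly_cayley_mx //; elim/big_ind: _ => [|f g|k _].
  - exact: dvdp0.
  - exact: dvdp_add.
  rewrite -mul_polyC dvdp_mull // dvdp_cayley_quotient_coef //.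
    exact: dvdp_gcdl.
  exact: dvdp_gcdr.
have [[a b] /= /eqp_dvdl <-] := Bezoutp P Q.
case/dvdpP => h Eu.
have [w [e Ew]] := mul_mod_row_space_cayley_mx (h * b) sP sQ.
pose v := u - w *m cayley_mx n P Q; pose e' := h * a + e.
have Ev : rVpoly v = e' * P.
  by rewrite linearB /= Eu mulrDr !mulrA Ew /e'; ring.
have [e0 | e_neq0] := eqVneq e' 0.
  apply/submxP; exists w; apply/eqP; rewrite -subr_eq0 -/v.
  by rewrite -[v]rVpolyK Ev e0 mul0r linear0.
(* A nonzero multiple of P is too large to be encoded by a vector of size n. *)
have : (size (rVpoly v) <= n)%N by exact: size_poly.
rewrite Ev size_mul // -?size_poly_gt0 ?sP // addnS /=.
by rewrite leqNgt -[X in (X < _)%N]add0n ltn_add2r size_poly_gt0 e_neq0.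
Qed.

(** One of [P] and [Q] has degree [n]; by the antisymmetry of the Cayley
    quotient it does not matter which. *)
Lemma row_space_cayley_mx (F : fieldType) n (P Q : {poly F}) (u : 'rV[F]_n) :
  P != 0 -> n = (maxn (size P) (size Q)).-1 ->
  (u <= cayley_mx n P Q)%MS = (gcdp P Q %| rVpoly u).
Proof.
move=> P0 En.
have /esym Emax : n.+1 = maxn (size P) (size Q).
  by rewrite En prednK // (leq_trans _ (leq_maxl _ _)) // size_poly_gt0.
have [sP sQ] : (size P <= n.+1 /\ size Q <= n.+1)%N.
  by rewrite -Emax leq_maxl leq_maxr.
have [sPn | sPn] := eqVneq (size P) n.+1; first exact: row_space_cayley_mx_lead.
have sQn : size Q = n.+1.
  by move: Emax sPn; rewrite /maxn; case: ifP => // _ ->; rewrite eqxx.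
rewrite (eqp_dvdl _ (gcdpC P Q)) -row_space_cayley_mx_lead //.
suff -> : cayley_mx n Q P = - cayley_mx n P Q by rewrite eqmx_opp.
by apply/matrixP => i j; rewrite !mxE cayley_quotientC !coefN.
Qed.

(** * Divisibility read off on derivatives at the roots *)

(** From left to right, one derivation costs one factor ['X - z%:P].  From right
    to left, the Taylor coefficients of [f] at [z] are the derivatives divided
    by factorials, which are invertible in characteristic zero. *)
Lemma dvdp_XsubCX_derivn (F : fieldType) (char0 : [pchar F] =i pred0)
    (f : {poly F}) z m :
  (('X - z%:P) ^+ m %| f) <-> (forall l, (l < m)%N -> f^`(l).[z] = 0).
Proof.
split=> [|H].
  elim: m f => [|m IHm] f // /dvdpP[h ->] [|l] lm.
    by rewrite derivn0 exprS !hornerM hornerXsubC subrr mul0r mulr0.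
  rewrite derivSn; apply: IHm => //.
  rewrite derivM deriv_exp derivXsubC mul1r dvdp_add ?dvdp_mull //.
    by rewrite dvdp_exp2l.
  by rewrite -mulr_natr dvdp_mulr.
have -> : f = \sum_(i < size f) (f^`N(i).[z])%:P * ('X - z%:P) ^+ i.
  (* Evaluate f, with coefficients lifted to {poly F}, at 'X = z + ('X - z). *)
  have : (map_poly polyC f).[z%:P + ('X - z%:P)] = f.
    by rewrite addrC subrK; exact: comp_polyXr.
  rewrite nderiv_taylor; last exact: mulrC.
  rewrite size_map_polyC => {1}<-; apply: eq_bigr => i _.
  by rewrite nderivn_map horner_map.
elim/big_ind: _ => [|g h|i _]; [exact: dvdp0 | exact: dvdp_add|].
have [lti|lei] := ltnP i m; last by rewrite dvdp_mull // dvdp_exp2l.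
have := H i lti; rewrite nderivn_def hornerMn -mulr_natl => /eqP.
have /pcharf0P char0P := char0.
rewrite mulf_eq0 char0P -[_ == 0%N]negbK -lt0n fact_gt0 /= => /eqP ->.
by rewrite mul0r dvdp0.
Qed.

Lemma dvdp_prod_XsubC_count (F : fieldType) (s : seq F) (f : {poly F}) :
  (forall z, ('X - z%:P) ^+ count_mem z s %| f) ->
  \prod_(z <- s) ('X - z%:P) %| f.
Proof.
elim: s f => [|z s IHs] f sf; first by rewrite big_nil dvd1p.
have /dvdpP[f' Ef] : 'X - z%:P %| f.
  by apply: dvdp_trans (sf z); rewrite /= eqxx exprS dvdp_mulIl.
rewrite big_cons Ef mulrC dvdp_mul2r ?polyXsubC_eq0 //; apply: IHs => y.
have := sf y; rewrite Ef /=; have [-> | neq_zy] := eqVneq z y.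
  by rewrite exprSr dvdp_mul2r ?polyXsubC_eq0.
by rewrite add0n Gauss_dvdpl // coprimep_expl // coprimep_XsubC root_XsubC.
Qed.

(** When [g] splits, its primary factors at distinct roots are coprime, so
    divisibility by [g] can be tested one root at a time. *)
Lemma dvdp_split_mup (F : fieldType) (s : seq F) (f g : {poly F}) :
  g %= \prod_(z <- s) ('X - z%:P) ->
  (g %| f) <-> (forall z, ('X - z%:P) ^+ mup z g %| f).
Proof.
move=> gs; have prod_neq0 : \prod_(z <- s) ('X - z%:P) != 0.
  by rewrite monic_neq0 ?monic_prod_XsubC.
have g0 : g != 0.
  by apply: contraTneq gs => ->; rewrite eqp_sym eqp0.
split=> [gf z | gf]; first by apply: dvdp_trans gf; rewrite -mup_geq.
rewrite (eqp_dvdl _ gs); apply: dvdp_prod_XsubC_count => z.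
apply: dvdp_trans (gf z); apply: dvdp_exp2l.
by rewrite mup_geq // (eqp_dvdr _ gs) -mup_geq ?mu_prod_XsubC.
Qed.

(** * Duality between row spaces and null spaces *)

(** The columns of the transposed cokernel of [M^T] are the linear forms
    vanishing on the column space of [M].  They lie in the left kernel of [M],
    which is the row space of [A], so they vanish on the null space of [A]. *)
Lemma null_space_eq_col_space (F : fieldType) m n p
    (A : 'M[F]_(m, n)) (M : 'M_(n, p)) :
  (forall u : 'rV_n, (u <= A)%MS <-> u *m M = 0) ->
  forall v : 'cV_n, A *m v = 0 <-> exists c, v = M *m c.
Proof.
move=> AM v; split=> [Av0 | [c ->]].
  suff /submxP[c Ec] : (v^T <= M^T)%MS.
    by exists c^T; rewrite -[v]trmxK Ec trmx_mul trmxK.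
  rewrite submxE; apply/eqP; apply: trmx_inj; rewrite trmx_mul trmxK trmx0.
  suff /submxP[D ->] : ((cokermx M^T)^T <= A)%MS by rewrite -mulmxA Av0 mulmx0.
  apply/row_subP => i; apply/AM.
  by rewrite -row_mul -[M in _ *m M]trmxK -trmx_mul mulmx_coker trmx0 row0.
suff AM0 : A *m M = 0 by rewrite mulmxA AM0 mul0mx.
by apply/row_matrixP => i; rewrite row_mul row0; apply/AM; rewrite row_sub.
Qed.

(** * Change of basis *)

Definition basis_coef_mx (K : fieldType) n (Phi : n.-tuple {poly_n K}) :
    'M[K]_n :=
  \matrix_(i < n) poly_rV (tnth Phi i : {poly K}).

Lemma rVpoly_basis_coef (K L : fieldType) (iota : {rmorphism K -> L}) n
    (Phi : n.-tuple {poly_n K}) (u : 'rV[L]_n) :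
  rVpoly (u *m map_mx iota (basis_coef_mx Phi)) =
  \sum_(i < n) u 0 i *: map_poly iota (tnth Phi i : {poly K}).
Proof.
rewrite mulmx_sum_row linear_sum; apply: eq_bigr => i _.
by rewrite linearZ /= -map_row rowK -map_rVpoly poly_rV_K ?size_npoly.
Qed.

Lemma basis_coef_mx_unit (K : fieldType) n (Phi : n.-tuple {poly_n K}) :
  basis_of fullv Phi -> basis_coef_mx Phi \in unitmx.
Proof.
move=> bPhi; rewrite -row_free_unit; apply: inj_row_free => u uA0.
apply/rowP => i; rewrite mxE; move: i.
have /freeP := basis_free bPhi; apply; apply: val_inj.
have uA0' := congr1 rVpoly uA0; rewrite linear0 in uA0'.
rewrite /= raddf_sum /= -[RHS]uA0' mulmx_sum_row linear_sum.
apply: eq_bigr => i _.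
by rewrite linearZ /= rowK poly_rV_K ?size_npoly // (tnth_nth 0).
Qed.

Lemma cayley_mx_bezout (K : fieldType) n (Phi : n.-tuple {poly_n K})
    (P Q : {poly K}) B :
  is_bezout_mx Phi P Q B ->
  cayley_mx n P Q = (basis_coef_mx Phi)^T *m B *m basis_coef_mx Phi.
Proof.
move=> HB; apply/matrixP => k l; rewrite !mxE HB exchange_big !coef_sum.
apply: eq_bigr => j _; rewrite !coef_sum !mxE mulr_suml.
apply: eq_bigr => i _.
by rewrite coefMC coefCM coef_map /= -polyCM coefCM !mxE [_ * B i j]mulrC.
Qed.

(** * The null space of the Bezout matrix *)

Theorem corollary1 (K : fieldType) (char0 : [pchar K] =i pred0)
    (P Q : {poly K}) (P_neq0 : P != 0) (Q_neq0 : Q != 0)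
    (not_proportional : ~ exists c : K, P = c *: Q)
    (n : nat) (n_def : n = (maxn (size P) (size Q)).-1)
    (Phi : n.-tuple {poly_n K}) (Phi_basis : basis_of fullv Phi)
    (B : 'M[K]_n) (B_bezout : is_bezout_mx Phi P Q B)
    (L : fieldType) (iota : {rmorphism K -> L})
    (L_splits : splits_over iota (gcdp P Q))
    (k : nat) (x : 'I_k -> L) (x_inj : injective x)
    (x_common : forall z : L,
       (root (map_poly iota P) z /\ root (map_poly iota Q) z) <->
       exists j : 'I_k, z = x j) :
  forall v : 'cV[L]_n,
    map_mx iota B *m v = 0 <->
    exists c : 'cV[L]_(\sum_(j < k) mup (x j) (map_poly iota (gcdp P Q))),
      v = (\mxrow_(j < k)
             root_block iota Phi (x j)
               (mup (x j) (map_poly iota (gcdp P Q)))) *m c.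
Proof.
set PL := map_poly iota P; set QL := map_poly iota Q.
set g := map_poly iota (gcdp P Q); set A := map_mx iota (basis_coef_mx Phi).
have uA : A \in unitmx by rewrite map_unitmx basis_coef_mx_unit.
have char0L : [pchar L] =i pred0 by move=> p; rewrite (fmorph_pchar iota).
have [s gs] := L_splits.
apply: null_space_eq_col_space => u.
have -> : (u <= map_mx iota B)%MS = (g %| rVpoly (u *m A)).
  rewrite -(submxMfree _ _ (_ : row_free A)) ?row_free_unit //.
  rewrite /g gcdp_map -row_space_cayley_mx ?map_poly_eq0 ?size_map_poly //.
  rewrite -map_cayley_mx (cayley_mx_bezout B_bezout) !map_mxM -map_trmx -mulmxA.
  by rewrite (eqmxMfull (_ *m _)) // row_full_unit unitmx_tr.
rewrite rVpoly_basis_coef mul_mxrow -[X in _ <-> _ = X]mxrow0.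
have blockE (j : 'I_k) m (l : 'I_m) : (u *m root_block iota Phi (x j) m) 0 l =
    (\sum_(i < n) u 0 i *: map_poly iota (tnth Phi i : {poly K}))^`(l).[x j].
  rewrite mxE raddf_sum horner_sum; apply: eq_bigr => i _.
  by rewrite mxE /= derivnZ hornerZ.
rewrite -eq_mxrowP (dvdp_split_mup _ gs) -/g; split=> [gf j | uM0 z].
  apply/rowP => l; rewrite blockE mxE.
  exact: (dvdp_XsubCX_derivn char0L _ _ _).1 (gf (x j)) _ (ltn_ord l).
have g0 : g != 0 by rewrite map_poly_eq0 gcdp_eq0 negb_and P_neq0.
have [-> | mup_gt0] := posnP (mup z g); first by rewrite expr0 dvd1p.
have /x_common[j ->] : root PL z /\ root QL z.
  by apply/andP; rewrite -root_gcd -gcdp_map -/g -dvdp_XsubCl XsubC_dvd.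
apply/(dvdp_XsubCX_derivn char0L) => l ltl.
by rewrite -(blockE j _ (Ordinal ltl)) uM0 mxE.
Qed.
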